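(* For all $n\ge 1$, $\mathrm{rc}(\mathrm{DIFF}_{2,n})\ge 2^n$, where $\mathrm{DIFF}_{2,n}=\{x\in\{0,1\}^{2\times n}: \text{the two rows of } x \text{ are distinct}\}$.
   Context: For $X\subseteq\mathbb{Z}^d$ (here $d=2n$, identifying $\mathbb{R}^{2\times n}$ with $\mathbb{R}^{2n}$), a polyhedron $R\subseteq\mathbb{R}^d$ is called a relaxation for $X$ if $R\cap\mathbb{Z}^d=\mathrm{conv}(X)\cap\mathbb{Z}^d$. The relaxation complexity $\mathrm{rc}(X)$ is the smallest number of facets of any relaxation for $X$. *)

(* Defs.v *)
From mathcomp Require Import all_boot all_order all_algebra.
From mathcomp Require Import mathcomp_extra boolp classical_sets functions.
From mathcomp Require Import cardinality reals ereal topology convex measure.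

Set Implicit Arguments.
Unset Strict Implicit.
Unset Printing Implicit Defensive.

Import Order.TTheory GRing.Theory Num.Theory.

Local Open Scope classical_set_scope.
Local Open Scope ring_scope.

Section Polyhedra.
Context {R : realType} {d : nat}.
Implicit Types (P F G : set 'rV[R]_d) (X : set 'rV[int]_d) (c x : 'rV[R]_d).

Definition dotr c x : R := (c *m x^T) 0 0.

Definition polyhedron P : Prop :=
  exists (m : nat) (A : 'M[R]_(m, d)) (b : 'cV[R]_m),
    P = [set x | forall i, (A *m x^T) i 0 <= b i 0].

(* The pair (0, 0) shows that [P] is a face of itself. *)
Definition face P F : Prop :=
  exists (c : 'rV[R]_d) (delta : R),
    (forall x, P x -> dotr c x <= delta) /\
    F = P `&` [set x | dotr c x = delta].

Definition proper_face P F : Prop := [/\ face P F, F !=set0 & F <> P].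

Definition facet P F : Prop :=
  proper_face P F /\ forall G, proper_face P G -> F `<=` G -> G = F.

(* [counting] takes the value [+oo] on infinite sets; a polyhedron has only
   finitely many facets. *)
Definition nb_facets P : \bar R := counting [set F | facet P F].

Definition int_embed (z : 'rV[int]_d) : 'rV[R]_d := map_mx intr z.

Definition int_points : set 'rV[R]_d := range int_embed.

Definition conv_hull (S : set 'rV[R]_d) : set 'rV[R]_d :=
  smallest (@convex_set R 'rV[R]_d) S.

Definition relaxation X P : Prop :=
  polyhedron P /\
  P `&` int_points = conv_hull (int_embed @` X) `&` int_points.

End Polyhedra.

(* A set with no relaxation has relaxation complexity [+oo]; otherwise the
   infimum, of values in nat or [+oo], is attained. *)
Definition rc (R : realType) (d : nat) (X : set 'rV[int]_d) : \bar R :=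
  ereal_inf [set nb_facets P | P in [set P : set 'rV[R]_d | relaxation X P]].

(* [mxvec] realizes the identification of 2 x n matrices with vectors of
   length 2 * n. *)
Definition DIFF2 (n : nat) : set 'rV[int]_(2 * n) :=
  mxvec @` [set x : 'M[int]_(2, n) |
    (forall i j, x i j = 0 \/ x i j = 1) /\ row 0 x <> row 1 x].

Arguments DIFF2 n : clear implicits.

(* Main.v *)
(* A hiding set argument: let H be a set of integer points of the affine hull
   of X outside conv(X) such that the midpoint of any two of them lies in
   conv(X).  For a relaxation P and h in H, the segment from a relative interior
   point of P to h leaves P through some facet, all of whose defining
   inequalities are then violated at h.  An inequality violated at two points of
   H would be violated at their midpoint, so distinct points of H yield distinct
   facets.  For n >= 2 the 2^n matrices with two equal 0/1 rows form such a set;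
   for n = 1 they are not in the affine hull of X, and the columns (2, -1) and
   (-1, 2) are used instead. *)
Require Import Defs.
From mathcomp Require Import all_boot all_order all_algebra.
From mathcomp Require Import boolp classical_sets reals ereal.
From mathcomp Require Import lra.
From mathcomp Require Import cardinality finmap interval_inference convex measure.

Set Implicit Arguments.
Unset Strict Implicit.
Unset Printing Implicit Defensive.

Import Order.TTheory GRing.Theory Num.Theory.

(** * Faces and facets of a finite intersection of halfspaces *)

Section FaceLattice.
Context {R : realType} {d : nat} {I : finType}.
Local Open Scope classical_set_scope.
Local Open Scope ring_scope.
Implicit Types (P F G : set 'rV[R]_d) (c x y z : 'rV[R]_d) (a : I -> 'rV[R]_d)
  (b : I -> R).

Lemma dotrD c x y : dotr c (x + y) = dotr c x + dotr c y.
Proof. by rewrite /dotr linearD mulmxDr mxE. Qed.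

Lemma dotrZ c k x : dotr c (k *: x) = k * dotr c x.
Proof. by rewrite /dotr linearZ -scalemxAr mxE. Qed.

Lemma dotrB c x y : dotr c (x - y) = dotr c x - dotr c y.
Proof. by rewrite -scaleN1r dotrD dotrZ mulN1r. Qed.

Definition halfspaces a b : set 'rV[R]_d :=
  [set x | forall i, dotr (a i) x <= b i].

Lemma halfspaces_extend a b x z :
  halfspaces a b x -> halfspaces a b z ->
  (forall i, dotr (a i) z = b i -> dotr (a i) x = b i) ->
  exists2 e, 0 < e & halfspaces a b (z + e *: (z - x)).
Proof.
move=> Px Pz tight.
(* [s i] is a step length that the slack of constraint [i] at [z] permits; the summand 1 keeps the
   denominator positive. *)
pose s i := (b i - dotr (a i) z) / (1 + `|dotr (a i) z - dotr (a i) x|).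
have den_gt0 i : 0 < 1 + `|dotr (a i) z - dotr (a i) x|.
  by rewrite ltr_pwDl.
exists (\big[Order.min/1]_(i | dotr (a i) z < b i) s i).
  apply: lt_bigmin => // i ltb.
  by rewrite divr_gt0// subr_gt0.
move=> i; rewrite dotrD dotrZ dotrB.
have [eqb|neqb] := eqVneq (dotr (a i) z) (b i).
  by rewrite eqb (tight _ eqb) subrr mulr0 addr0.
have ltb : dotr (a i) z < b i by rewrite lt_neqAle neqb Pz.
rewrite -lerBrDl.
set e := \big[_/_]_(_ | _) _.
have e0 : 0 <= e.
  apply/ltW/lt_bigmin => // j ltbj.
  by rewrite divr_gt0// subr_gt0.
have es : e <= s i by apply: bigmin_le_cond.
apply: (@le_trans _ _ (e * (1 + `|dotr (a i) z - dotr (a i) x|))).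
  by rewrite ler_wpM2l// (le_trans (ler_norm _))// lerDr.
by rewrite -ler_pdivlMr.
Qed.

Lemma face_midpoint P F x y :
  (forall u v, P u -> P v -> P (2^-1 *: (u + v))) ->
  face P F -> F x -> F y -> F (2^-1 *: (x + y)).
Proof.
move=> midP [c [delta [_ ->]]] [Px cx] [Py cy]; split; first exact: midP.
by move: cx cy; rewrite /= dotrZ dotrD => -> ->; lra.
Qed.

Lemma halfspaces_midpoint a b x y :
  halfspaces a b x -> halfspaces a b y -> halfspaces a b (2^-1 *: (x + y)).
Proof.
by move=> Px Py i; rewrite dotrZ dotrD; move: (Px i) (Py i); lra.
Qed.

Lemma face_self P : face P P.
Proof.
exists 0, 0; have dot0 x : dotr 0 x = 0 by rewrite /dotr mul0mx mxE.
split=> [x _|]; first by rewrite dot0.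
by apply/seteqP; split=> [x Px|x []//]; split=> //=; rewrite dot0.
Qed.

Lemma face_sub P F : face P F -> F `<=` P.
Proof. by move=> [c [delta [_ ->]]] x []. Qed.

(** A constraint not tight on all of [F] is made slack by averaging with a point of [F] where it is
    slack. Tightness at a midpoint forces tightness at both ends, so slackness already gained
    persists. *)
Lemma face_relint a b F : face (halfspaces a b) F -> F !=set0 ->
  exists2 z, F z & forall i, dotr (a i) z = b i ->
    forall x, F x -> dotr (a i) x = b i.
Proof.
move=> faceF [x0 Fx0]; have FP := face_sub faceF.
suff [z Fz tz] : exists2 z, F z & forall i, i \in enum I ->
    dotr (a i) z = b i -> forall x, F x -> dotr (a i) x = b i.
  by exists z => // i; apply: tz; rewrite mem_enum.
elim: (enum I) => [|i s [z Fz tz]]; first by exists x0.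
have [tight|/existsNP[x /not_implyP[Fx ntx]]] :=
    pselect (forall x, F x -> dotr (a i) x = b i).
  by exists z => // j /predU1P[->//|js]; apply: tz.
exists (2^-1 *: (z + x)).
  exact: face_midpoint (@halfspaces_midpoint a b) faceF _ _.
move=> j js; rewrite dotrZ dotrD => tj.
have := FP _ Fx j; have := FP _ Fz j => lez lex.
have tjz : dotr (a j) z = b j by lra.
have tjx : dotr (a j) x = b j by lra.
by move: js => /predU1P[ji|/tz]; [subst j | exact].
Qed.

(** Finite data that determines a nonempty face; its cardinality serves as an induction measure. *)
Definition active a b F : {set I} :=
  [set i | `[< forall x, F x -> dotr (a i) x = b i >]].

Lemma active_sub a b F G : F `<=` G -> active a b G \subset active a b F.
Proof.
move=> FG; apply/fintype.subsetP => i; rewrite !inE => /asboolP tG.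
by apply/asboolP => x /FG; exact: tG.
Qed.

(* A point of [P] where all constraints active on [F] are tight cannot have
   [dotr c x < delta]: moving from a relative interior point of [F] slightly away
   from [x] would stay in [P] and violate the valid inequality. *)
Lemma face_activeP a b F : face (halfspaces a b) F -> F !=set0 ->
  F = halfspaces a b `&`
      [set x | forall i, i \in active a b F -> dotr (a i) x = b i].
Proof.
move=> faceF F0; have [z Fz tz] := face_relint faceF F0.
apply/seteqP; split => x.
  move=> Fx; split; first exact: (face_sub faceF).
  by move=> i; rewrite inE => /asboolP; apply.
move=> [Px tx].
have [//|e e0 Pe] := halfspaces_extend Px (face_sub faceF Fz).
  by move=> i /tz ti; apply: tx; rewrite inE; apply/asboolP.
case: faceF Fz => c [delta [valid FE]]; rewrite FE => -[Pz cz].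
split=> //=; apply/le_anti; rewrite valid//=.
move: (valid _ Pe); rewrite dotrD dotrZ dotrB cz gerDl pmulr_rle0//.
by rewrite subr_le0.
Qed.

(** A strictly larger proper face has strictly fewer active constraints, so climbing to larger faces
    stops at a facet. *)
Lemma facet_above a b F : proper_face (halfspaces a b) F ->
  exists2 G, facet (halfspaces a b) G & F `<=` G.
Proof.
have [k] := ubnP #|active a b F|; elim: k F => // k IH F /ltnSE leFk properF.
have [facetF|nfacet] := pselect (facet (halfspaces a b) F); first by exists F.
have /existsNP[G /not_implyP[properG /not_implyP[FG GF]]] :
    ~ (forall G, proper_face (halfspaces a b) G -> F `<=` G -> G = F).
  by move=> maxF; apply: nfacet.
have [H facetH GH] : exists2 H, facet (halfspaces a b) H & G `<=` H.
  apply: (IH G) => //; apply: leq_trans leFk; apply: proper_card.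
  rewrite finset.properEneq active_sub// andbT; apply: contra_notN GF => /eqP eqI.
  case: properG => faceG G0 _; case: properF => faceF F0 _.
  by rewrite (face_activeP faceG G0) (face_activeP faceF F0) eqI.
by exists H => //; apply: subset_trans GH.
Qed.

(* The hypothesis [h = u + v - w] puts [h] in the affine hull of [P], so that
   [h] can only violate constraints that are not tight on all of [P]. *)
Lemma facet_separates a b h u v w :
  halfspaces a b u -> halfspaces a b v -> halfspaces a b w -> h = u + v - w ->
  ~ halfspaces a b h ->
  exists2 F, facet (halfspaces a b) F &
    forall c delta, (forall x, halfspaces a b x -> dotr c x <= delta) ->
      F = halfspaces a b `&` [set x | dotr c x = delta] -> delta < dotr c h.
Proof.
set P := halfspaces a b => Pu Pv Pw hE nPh.
have [x0 Px0 tx0] := face_relint (face_self P) (ex_intro _ u Pu).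
have x0lt i : b i < dotr (a i) h -> dotr (a i) x0 < b i.
  move=> bh; rewrite lt_neqAle Px0 andbT; apply/eqP => /tx0 tP.
  by move: bh; rewrite hE dotrB dotrD !tP// addrK ltxx.
have [i1 bi1] : exists i, b i < dotr (a i) h.
  by apply: contrapT => /forallNP nb; apply: nPh => i; rewrite leNgt; apply/negP.
(* The segment from [x0] to [h] meets hyperplane [i] at parameter [t i]; the least value over the
   violated constraints gives the exit point [y]. *)
pose t i := (b i - dotr (a i) x0) / (dotr (a i) h - dotr (a i) x0).
case: (@arg_minP _ _ _ i1 (fun i => b i < dotr (a i) h) t bi1) => i bi tmin.
have := x0lt _ bi => x0i.
have den_gt0 j : b j < dotr (a j) h -> 0 < dotr (a j) h - dotr (a j) x0.
  by move=> bj; rewrite subr_gt0; exact: lt_trans (x0lt _ bj) bj.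
have t0 : 0 < t i by rewrite divr_gt0 ?subr_gt0// -subr_gt0 den_gt0.
have t1 : t i < 1 by rewrite ltr_pdivrMr ?den_gt0// mul1r ltrD2r.
pose y := x0 + t i *: (h - x0).
have dy c : dotr c y = dotr c x0 + t i * (dotr c h - dotr c x0).
  by rewrite dotrD dotrZ dotrB.
have tight_y : dotr (a i) y = b i.
  by rewrite dy divfK ?gt_eqF ?den_gt0// subrKC.
have Py : P y.
  move=> j; rewrite dy; have [bj|hj] := ltP (b j) (dotr (a j) h).
    rewrite -lerBrDl -ler_pdivlMr ?den_gt0//; exact: tmin.
  by move: (Px0 j) hj t0 t1; nra.
(* This face contains [y] and misses [x0], hence is proper. *)
have properF : proper_face P (P `&` [set x | dotr (a i) x = b i]).
  split; first by exists (a i), (b i); split=> // x; apply.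
    by exists y.
  by move=> FP; move: (Px0); rewrite -FP => -[_ /= x0b]; rewrite x0b ltxx in x0i.
have [F facetF /(_ y) Fy] := facet_above properF.
exists F => // c delta valid FE.
have [_ /= cy] : (P `&` [set x | dotr c x = delta]) y by rewrite -FE; apply: Fy.
(* If [x0] were in [F], the constraints active on [F] would be tight on all of [P], forcing
   [F = P]. *)
have x0F : dotr c x0 < delta.
  rewrite lt_neqAle valid// andbT; apply/eqP => cx0.
  case: facetF => -[faceF F0 neF] _; apply: neF.
  have Fx0 : F x0 by rewrite FE.
  rewrite (face_activeP faceF F0); apply/seteqP; split=> [x []//|x Px].
  split=> // j; rewrite inE => /asboolP tF; exact: tx0 (tF _ Fx0) _ Px.
(* Along the segment [c] is below [delta] at [x0] and equal to it at [y], so it exceeds it at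
   [h]. *)
move: cy x0F t0 t1; rewrite dy; nra.
Qed.

End FaceLattice.

(** * The hiding set bound *)

Section HidingSets.
Local Open Scope classical_set_scope.
Local Open Scope ring_scope.
Local Open Scope convex_scope.

Lemma convex_halfspace (R : realType) (d : nat) (c : 'rV[R]_d) (delta : R) :
  @convex_set R 'rV[R]_d [set x | dotr c x <= delta].
Proof.
move=> x y p /set_mem /= cx /set_mem /= cy; apply/mem_set => /=.
rewrite /conv/= dotrD !dotrZ /unstable.onem.
have : 0 <= p%:num by [].
have : p%:num <= 1 by [].
by move: cx cy; nra.
Qed.

Lemma counting_ge_inj (R : realType) (T : finType) (U : choiceType)
    (A : set U) (f : T -> U) :
  injective f -> (forall t, A (f t)) -> ((#|T|%:R : R)%:E <= counting A)%E.
Proof.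
move=> injf fA; rewrite /counting; case: asboolP => [finA|_]; last exact: leey.
rewrite lee_fin ler_nat cardE -(size_map f).
have -> : size (map f (enum T)) = #|` [fset x in map f (enum T)]%fset|.
  by rewrite card_fseq undup_id// map_inj_uniq// enum_uniq.
apply: fsubset_leq_card; apply/fsubsetP => F.
by rewrite inE => /mapP[t _ ->]; rewrite in_fset_set//; apply/mem_set.
Qed.

Lemma dotr_int_embed (R : realType) (d : nat) (c x : 'rV[int]_d) :
  dotr (int_embed c) (int_embed x) = ((c *m x^T) 0 0)%:~R :> R.
Proof. by rewrite /dotr /int_embed map_trmx -map_mxM mxE. Qed.

(** Integrality turns the strict inequalities into a gap of 1, so one closed halfspace contains [X]
    and excludes [h]. *)
Lemma conv_hull_separated (R : realType) (d : nat) (X : set 'rV[int]_d)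
    (c h : 'rV[int]_d) :
  (forall x, X x -> (c *m x^T) 0 0 < (c *m h^T) 0 0) ->
  ~ conv_hull (int_embed @` X) (int_embed h : 'rV[R]_d).
Proof.
move=> sep; pose delta : R := ((c *m h^T) 0 0 - 1)%:~R.
have : conv_hull (int_embed @` X) `<=` [set x | dotr (int_embed c) x <= delta].
  apply: smallest_sub; first exact: convex_halfspace.
  by move=> _ [x Xx <-] /=; rewrite dotr_int_embed ler_int -ltzD1 subrK sep.
by move=> hullS /hullS /=; rewrite dotr_int_embed ler_int lerDl.
Qed.

(** The hypotheses place each [h t] outside the hull, then in the affine hull, and midpoints of
    distinct pairs in the hull, all stated over the integers. *)
Lemma rc_ge_hiding_set (R : realType) (d : nat) (X : set 'rV[int]_d)
    (T : finType) (h : T -> 'rV[int]_d) :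
  (forall t, exists c : 'rV[int]_d,
    forall x, X x -> (c *m x^T) 0 0 < (c *m (h t)^T) 0 0) ->
  (forall t, exists u v w, [/\ X u, X v, X w & h t = u + v - w]) ->
  (forall s t, s != t -> exists u v, [/\ X u, X v & h s + h t = u + v]) ->
  ((#|T|%:R : R)%:E <= rc R X)%E.
Proof.
move=> out aff mid; apply: le_ereal_inf_tmp => _ [P [[m [A [b PE]]] relP] <-].
have rowE x i : dotr (row i A) x = (A *m x^T) i 0.
  by rewrite /dotr -row_mul mxE.
have {}PE : P = halfspaces (fun i => row i A) (fun i => b i 0).
  by rewrite PE; apply/seteqP; split=> x Px i; have := Px i; rewrite rowE.
have XP x : X x -> P (int_embed x).
  move=> Xx; suff [] : (P `&` int_points) (int_embed x) by [].
  by rewrite relP; split; [apply: sub_gen_smallest; exists x | exists x].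
have nPh t : ~ P (int_embed (h t)).
  have [c sep] := out t; move=> Ph; apply: (@conv_hull_separated R _ _ _ _ sep).
  have : (P `&` int_points) (int_embed (h t)) by split=> //; exists (h t).
  by rewrite relP => -[].
have sepF t : exists F, facet P F /\
    forall c delta, (forall x, P x -> dotr c x <= delta) ->
      F = P `&` [set x | dotr c x = delta] -> delta < dotr c (int_embed (h t)).
  have [u [v [w [Xu Xv Xw hE]]]] := aff t.
  have := @facet_separates R d _ (fun i => row i A) (fun i => b i 0)
    (int_embed (h t)) (int_embed u) (int_embed v) (int_embed w).
  rewrite -PE => /(_ (XP _ Xu) (XP _ Xv) (XP _ Xw)) [].
  - by rewrite hE /int_embed map_mxB map_mxD.
  - exact: nPh.
  - by move=> F ? ?; exists F.
have [f fP] := choice sepF.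
apply: (@counting_ge_inj _ _ _ _ f) => [s t fst|t]; last exact: (fP t).1.
(* An inequality defining the common facet would fail at [h s] and [h t] but hold at [u] and [v],
   although both pairs have the same sum. *)
apply: contrapT => /eqP /mid [u [v [Xu Xv uv]]].
have [[[[c [delta [valid FE]]] _ _] _] seps] := fP s.
have [_ sept] := fP t.
have lts := seps _ _ valid FE.
have ltt := sept _ _ valid (etrans (esym fst) FE).
have : dotr c (int_embed (h s)) + dotr c (int_embed (h t)) =
    dotr c (int_embed u) + dotr c (int_embed v).
  by rewrite -!dotrD /int_embed -!map_mxD uv.
by move: lts ltt (valid _ (XP _ Xu)) (valid _ (XP _ Xv)); lra.
Qed.

(** The functional has entry 1 where [v] is 1 and -1 where [v] is 0, so [v] is its unique maximizer
    on the cube. *)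
Lemma cube_vertex_separated (d : nat) (v x : 'rV[int]_d) :
  (forall k, v 0 k = 0 \/ v 0 k = 1) -> (forall k, x 0 k = 0 \/ x 0 k = 1) ->
  x <> v ->
  ((v + v - const_mx 1) *m x^T) 0 0 < ((v + v - const_mx 1) *m v^T) 0 0.
Proof.
move=> v01 x01 xv.
have [k xvk] : exists k, x 0 k != v 0 k.
  apply: contrapT => /forallNP eqxv; apply: xv; apply/rowP => k.
  by apply/eqP; apply: contrapT => /negP; exact: eqxv.
rewrite !mxE (bigD1 k)//= [ltRHS](bigD1 k)//=; apply: ltr_leD.
  by move: xvk; rewrite !mxE; case: (v01 k) => ->; case: (x01 k) => ->.
apply: ler_sum => j _; rewrite !mxE.
by case: (v01 j) => ->; case: (x01 j) => ->.
Qed.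

(** * Hiding sets for binary matrices with two rows *)

Definition bool_rows (n : nat) (f g : {ffun 'I_n -> bool}) : 'M[int]_(2, n) :=
  \matrix_(i, j) (if i == 0 then f j else g j)%:R.

Lemma bool_rows01 (n : nat) (f g : {ffun 'I_n -> bool}) i j :
  bool_rows f g i j = 0 \/ bool_rows f g i j = 1.
Proof.
by rewrite mxE; case: ifP => _; case: (_ j); [right|left|right|left].
Qed.

Lemma DIFF2_bool_rows (n : nat) (f g : {ffun 'I_n -> bool}) :
  f != g -> DIFF2 n (mxvec (bool_rows f g)).
Proof.
move=> fg; exists (bool_rows f g) => //; split; first exact: bool_rows01.
move/rowP => rows; case/eqP: fg; apply/ffunP => j.
by have := rows j; rewrite !mxE /=; case: (f j); case: (g j).
Qed.

Lemma DIFF2_01 (n : nat) (x : 'rV[int]_(2 * n)) k :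
  DIFF2 n x -> x 0 k = 0 \/ x 0 k = 1.
Proof.
by move=> [M [M01 _] <-]; case/mxvec_indexP: k => i j; rewrite mxvecE.
Qed.

Lemma rc_DIFF2_1 (R : realType) : ((2%:R : R)%:E <= rc R (DIFF2 1))%E.
Proof.
pose u (p : bool) := bool_rows [ffun=> p] [ffun=> ~~ p] : 'M[int]_(2, 1).
have Du p : DIFF2 1 (mxvec (u p)).
  by apply: DIFF2_bool_rows; apply/eqP => /ffunP /(_ 0); rewrite !ffunE; case: p.
rewrite -[X in X%:R]card_bool.
(* The hull is a segment with ends [u p] and [u (~~ p)]; the hiding points prolong it by its own
   length past each end. *)
apply: (@rc_ge_hiding_set R _ _ _ (fun p => mxvec (u p + u p - u (~~ p))))
  => [p|p|p q].
(* This functional reads the entry of the hiding point that equals 2. *)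
- exists (delta_mx 0 (mxvec_index (if p then 0 else 1) 0)) => x Dx.
  rewrite -!rowE !mxE mxvecE.
  by case: (DIFF2_01 (mxvec_index (if p then 0 else 1) 0) Dx) => ->;
    rewrite !mxE; case: p; rewrite /= !ffunE.
- by exists (mxvec (u p)), (mxvec (u p)), (mxvec (u (~~ p))); split=> //;
    rewrite linearB linearD.
- move=> pq; exists (mxvec (u p)), (mxvec (u q)); split=> //.
  have -> : q = ~~ p by move: p q pq => [] [].
  by rewrite negbK -!linearD /=; congr mxvec; rewrite addrACA -opprD
    [u (~~ p) + u p]addrC addrACA [u p + u (~~ p) + _ - _]addrK.
Qed.

Lemma rc_DIFF2_ge2 (R : realType) (n : nat) :
  (((2 ^ n.+2)%N%:R : R)%:E <= rc R (DIFF2 n.+2))%E.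
Proof.
have -> : (2 ^ n.+2 = #|{ffun 'I_n.+2 -> bool}|)%N.
  by rewrite card_ffun card_bool card_ord.
apply: (@rc_ge_hiding_set R _ _ _ (fun f => mxvec (bool_rows f f))) => [f|f|f g fg].
- exists (mxvec (bool_rows f f) + mxvec (bool_rows f f) - const_mx 1) => x Dx.
  apply: cube_vertex_separated => [k|k|xE]; [|exact: DIFF2_01 Dx|].
    by case/mxvec_indexP: k => i j; rewrite mxvecE; apply: bool_rows01.
  case: Dx => M [_ rowM]; rewrite xE => /(congr1 vec_mx); rewrite !mxvecK => ME.
  by apply: rowM; rewrite ME; apply/rowP => j; rewrite !mxE /= ?if_same.
(* Flipping the top row in column 0 and the bottom row in column 1 keeps the rows distinct even when
   both flips are made; this takes two columns. *)
- pose flip a : {ffun 'I_n.+2 -> bool} := [ffun j => f j (+) (j == a)].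
  exists (mxvec (bool_rows (flip 0) f)), (mxvec (bool_rows f (flip 1))),
    (mxvec (bool_rows (flip 0) (flip 1))); split.
  + apply: DIFF2_bool_rows; apply/eqP => /ffunP /(_ 0).
    by rewrite !ffunE eqxx; case: (f 0).
  + apply: DIFF2_bool_rows; apply/eqP => /ffunP /(_ 1).
    by rewrite !ffunE eqxx; case: (f 1).
  + apply: DIFF2_bool_rows; apply/eqP => /ffunP /(_ 0).
    by rewrite !ffunE eqxx; case: (f 0).
  + rewrite -linearD -linearB /=; congr mxvec; apply/matrixP => i j.
    by rewrite !mxE; case: ifP => _; rewrite ?addrK // addrAC subrr add0r.
(* Exchanging the bottom rows of the two hiding points preserves their sum. *)
- exists (mxvec (bool_rows f g)), (mxvec (bool_rows g f)).
  split; [exact: DIFF2_bool_rows|by apply: DIFF2_bool_rows; rewrite eq_sym|].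
  rewrite -!linearD /=; congr mxvec; apply/matrixP => i j.
  by rewrite !mxE; case: ifP => _ //; rewrite addrC.
Qed.

End HidingSets.

Theorem theorem5 (R : realType) (n : nat) (hn : (1 <= n)%N) :
  (((2 ^ n)%N%:R : R)%:E <= rc R (DIFF2 n))%E.
Proof.
by case: n hn => [//|[|n] _]; [exact: rc_DIFF2_1 | exact: rc_DIFF2_ge2].
Qed.
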